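(* Let $T,k\ge1$, $\tau\in(0,1)$ with $\tau\ne1/2$, $q_0=1/2$, $q_1=\tau$, and let $P^{\mathrm{obs}}$ be a Borel probability law of $(Y,X)$, $Y\in\mathbb R^T$, $X=(X_1,\dots,X_T)$, $X_t\in\mathbb R^k$. Let $\Theta_I^{0,\tau}$ be the joint coupling set (defined in the context). Then $\Theta_I^{0,\tau}$ is the sharp identified set for $(\beta(1/2),\beta(\tau),\rho(\tau))$ under the model $Q_{q_\ell}(Y_t\mid X,A)=X_t'\beta(q_\ell)+\rho(q_\ell)A$, $\ell\in\{0,1\}$, $t=1,\dots,T$, the normalization $\rho(1/2)=1$, and the restriction $\rho(\tau)>0$. That is, for $(b_0,b_1,r)\in\mathbb R^k\times\mathbb R^k\times(0,\infty)$ one has $(b_0,b_1,r)\in\Theta_I^{0,\tau}$ if and only if there exists a Borel probability law $P$ of $(Y,X,A)$, $A\in\mathbb R$, with $(Y,X)$-marginal $P^{\mathrm{obs}}$ such that, $P$-a.s. and for every $t$, $$P(Y_t\le X_t'b_0+A\mid X,A)\ge\tfrac12,\qquad P(Y_t<X_t'b_0+A\mid X,A)\le\tfrac12,$$ $$P(Y_t\le X_t'b_1+rA\mid X,A)\ge\tau,\qquad P(Y_t<X_t'b_1+rA\mid X,A)\le\tau .$$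
   Context: For $\theta=(b_0,b_1,r)$ with $r>0$ define the transformed residuals $Z_{0t}(\theta)=Y_t-X_t'b_0$ and $Z_{1t}(\theta)=(Y_t-X_t'b_1)/r$. $\mathcal C_\theta^{0,\tau}(P^{\mathrm{obs}})$ is the set of Borel probability laws $\pi$ of $(Y,X,A)$, $A\in\mathbb R$, with $(Y,X)$-marginal $P^{\mathrm{obs}}$, such that $\pi$-a.s., simultaneously for $\ell=0,1$ and $t=1,\dots,T$, $\pi\{Z_{\ell t}(\theta)\le A\mid X,A\}\ge q_\ell$ and $\pi\{Z_{\ell t}(\theta)<A\mid X,A\}\le q_\ell$. $\Theta_I^{0,\tau}=\{(b_0,b_1,r):r>0,\ \mathcal C_\theta^{0,\tau}(P^{\mathrm{obs}})\ne\varnothing\}$. Conditional-quantile equalities are interpreted in the set-valued sense: $c$ is an admissible conditional $q$-quantile of $Y_t$ if $P(Y_t\le c\mid X,A)\ge q$ and $P(Y_t<c\mid X,A)\le q$. *)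

(* Defs.v *)
From HB Require Import structures.
From mathcomp Require Import all_boot all_order all_algebra.
From mathcomp Require Import all_classical all_reals all_analysis.
From mathcomp Require Import measurable_realfun.

Set Implicit Arguments.
Unset Strict Implicit.
Unset Printing Implicit Defensive.

Import Order.TTheory GRing.Theory Num.Theory.

Local Open Scope classical_set_scope.
Local Open Scope ring_scope.

(* [g] is a version of s |-> P(E | S = s), i.e. [g \o S] is a version of the
   conditional probability of E given the sigma-algebra generated by S
   (S a measurable map). *)
Definition is_cprob {d d'} {O : measurableType d} {W : measurableType d'}
    {R : realType} (P : probability O R) (S : O -> W) (E : set O)
    (g : W -> R) : Prop :=
  [/\ measurable_fun [set: W] g,
      P.-integrable [set: O] (fun w => (g (S w))%:E) &
      forall B : set W, measurable B ->
        (\int[P]_(w in S @^-1` B) (g (S w))%:E = P (E `&` S @^-1` B))%E].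

(* P(E | S = s), for an arbitrarily chosen version: [cprobP] shows that one
   exists and [cprob_unique] that the choice is immaterial up to P-null sets. *)
Definition cprob {d d'} {O : measurableType d} {W : measurableType d'}
    {R : realType} (P : probability O R) (S : O -> W) (E : set O) : W -> R :=
  xget (cst 0) [set g | is_cprob P S E g].

Section cprob_theory.
Context {d d'} {O : measurableType d} {W : measurableType d'} {R : realType}.
Variables (P : probability O R) (S : O -> W).
Hypothesis mS : measurable_fun [set: O] S.

Lemma is_cprob_exists (E : set O) :
  measurable E -> exists g, is_cprob P S E g.
Proof.
move=> mE.
pose S' : {mfun O >-> W} := HB.pack S (isMeasurableFun.Build _ _ _ _ S mS).
have PEoo : (P E < +oo)%E by rewrite (le_lt_trans (probability_le1 P mE))// ltry.

have [nu nuE] : exists nu : {finite_measure set W -> \bar R},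
    forall B, nu B = P (S @^-1` B `&` E).
  pose nu0 : {measure set W -> \bar R} := pushforward (mrestr P mE) S'.
  have [nu1 nu1E] : exists nu1 : {measure set W -> \bar R},
    forall B, nu1 B = P (S @^-1` B `&` E) by exists (nu0 mS).
  have nu1oo : (nu1 [set: W] < +oo)%E by rewrite nu1E preimage_setT setTI.
  by exists (mfrestr measurableT nu1oo) => B; rewrite /= /mfrestr /mrestr setIT nu1E.
pose mu : probability W R := distribution P S'.
have numu : charge_of_finite_measure nu `<< mu.
  apply/null_content_dominatesP => B mB muB0.
  apply/eqP; rewrite eq_le; apply/andP; split; last exact: (measure_ge0 nu).
  rewrite -muB0 /charge_of_finite_measure/= nuE.
  have mSB : measurable (S @^-1` B) by rewrite -[X in measurable X]setTI; exact: mS.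
  by rewrite /distribution /pushforward/= le_measure// inE//; exact: measurableI.
pose f := Radon_Nikodym (charge_of_finite_measure nu) mu.
have ffin x : f x \is a fin_num by exact: Radon_Nikodym_fin_num.
have fi : mu.-integrable [set: W] f by exact: Radon_Nikodym_integrable.
have mf : measurable_fun [set: W] f by exact: measurable_int fi.
have fE : (fun w => (fine (f (S w)))%:E) = f \o S.
  by apply/funext => w /=; rewrite fineK.
have fSi : P.-integrable [set: O] (f \o S).
  have /integrableP[_ fioo] := fi.
  apply/integrableP; split; first exact: measurableT_comp.
  move: fioo; rewrite ge0_integral_pushforward//.
  exact: measurableT_comp.
exists (fine \o f); split.
- exact: measurableT_comp.
- by rewrite [X in integrable _ _ X]fE.
- move=> B mB.
  have mSB : measurable (S @^-1` B) by rewrite -[X in measurable X]setTI; exact: mS.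
  rewrite [X in integral _ _ X = _]fE.
  have -> : P (E `&` S @^-1` B) = charge_of_finite_measure nu B.
    by rewrite /charge_of_finite_measure/= nuE setIC.
  rewrite (Radon_Nikodym_integral numu mB) [RHS]integral_pushforward//.
  exact: (integrableS measurableT).
Qed.

Lemma cprobP (E : set O) : measurable E -> is_cprob P S E (cprob P S E).
Proof.
move=> /is_cprob_exists[g gP].
exact: (@xgetPex _ (cst 0) [set g | is_cprob P S E g] (ex_intro _ g gP)).
Qed.

Lemma cprob_unique (E : set O) (g h : W -> R) :
  is_cprob P S E g -> is_cprob P S E h ->
  {ae P, forall w, g (S w) = h (S w)}.
Proof.
move=> [mg ig gE] [mh ih hE].
have mEF (f : W -> R) : measurable_fun [set: W] f ->
    measurable_fun [set: W] (EFin \o f) by move=> ?; exact/measurable_EFinP.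
pose S' : {mfun O >-> W} := HB.pack S (isMeasurableFun.Build _ _ _ _ S mS).
pose mu : probability W R := distribution P S'.
have mui (f : W -> R) : measurable_fun [set: W] f ->
    P.-integrable [set: O] (fun w => (f (S w))%:E) ->
    mu.-integrable [set: W] (EFin \o f).
  by move=> mf fi; apply: integrable_pushforward => //; exact: mEF.
have muE (f : W -> R) B : measurable_fun [set: W] f ->
    P.-integrable [set: O] (fun w => (f (S w))%:E) -> measurable B ->
    (\int[mu]_(x in B) (f x)%:E = \int[P]_(w in S @^-1` B) (f (S w))%:E)%E.
  move=> mf fi mB; rewrite integral_pushforward//; first exact: mEF.
  apply: (integrableS measurableT) => //.
  by rewrite -[X in measurable X]setTI; exact: mS.
have : ae_eq mu [set: W] (EFin \o g) (EFin \o h).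
  apply: integral_ae_eq => //; [exact: mui|exact: mEF|].
  by move=> B _ mB; rewrite /= !muE// gE// hE.
move=> [N [mN N0 subN]]; exists (S @^-1` N); split.
- by rewrite -[X in measurable X]setTI; exact: mS.
- exact: N0.
- move=> w /= gh; apply: subN => /= /(_ I) [] gh'; exact: gh.
Qed.

End cprob_theory.

Local Notation obs R T k := (T.-tuple R * T.-tuple (k.-tuple R))%type.
Local Notation full R T k := (obs R T k * R)%type.
Local Notation par R k := (k.-tuple R * k.-tuple R * R)%type.

Section model.
Context {R : realType} {T k : nat}.

(* Observables (Y, X) and full data ((Y, X), A); the product sigma-algebras are
   the Borel ones. *)
Definition Yt (t : 'I_T) (w : full R T k) : R := tnth w.1.1 t.
Definition Xt (t : 'I_T) (w : full R T k) : k.-tuple R := tnth w.1.2 t.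
Definition At (w : full R T k) : R := w.2.
Definition XA (w : full R T k) : T.-tuple (k.-tuple R) * R := (w.1.2, w.2).

Definition dotp (x b : k.-tuple R) : R := \sum_(j < k) tnth x j * tnth b j.

Definition has_obs_marginal (Pobs : probability (obs R T k) R)
    (P : probability (full R T k) R) : Prop :=
  forall B : set (obs R T k), measurable B -> P (fst @^-1` B) = Pobs B.

Definition qlevel (tau : R) (l : 'I_2) : R := if l == ord0 then 2^-1 else tau.

Definition residual (theta : par R k) (l : 'I_2) (t : 'I_T)
    (w : full R T k) : R :=
  let: (b0, b1, r) := theta in
  if l == ord0 then Yt t w - dotp (Xt t w) b0
  else (Yt t w - dotp (Xt t w) b1) / r.

Definition coupling_set (Pobs : probability (obs R T k) R) (tau : R)
    (theta : par R k) : set (probability (full R T k) R) :=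
  [set P | has_obs_marginal Pobs P /\
    {ae P, forall w, forall (l : 'I_2) (t : 'I_T),
      qlevel tau l
        <= cprob P XA [set v | residual theta l t v <= At v] (XA w) /\
      cprob P XA [set v | residual theta l t v < At v] (XA w)
        <= qlevel tau l}].

Definition Theta_I (Pobs : probability (obs R T k) R) (tau : R) :
    set (par R k) :=
  [set theta | 0 < theta.2 /\ coupling_set Pobs tau theta !=set0].

(* [c] (a function of (X, A)) is an admissible conditional q-quantile of [V]
   given (X, A), at the point [w]. *)
Definition cond_quantile (P : probability (full R T k) R)
    (V : full R T k -> R) (q : R) (c : full R T k -> R) (w : full R T k) :
    Prop :=
  q <= cprob P XA [set v | V v <= c v] (XA w) /\
  cprob P XA [set v | V v < c v] (XA w) <= q.

(* The model Q_q(Y_t | X, A) = X_t' beta(q) + rho(q) A at the two levels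
   q = 1/2 and q = tau. *)
Definition quantile_model (tau : R) (beta : R -> k.-tuple R) (rho : R -> R)
    (P : probability (full R T k) R) : Prop :=
  {ae P, forall w, forall (l : 'I_2) (t : 'I_T),
    let q := qlevel tau l in
    cond_quantile P (Yt t) q
      (fun v => dotp (Xt t v) (beta q) + rho q * At v) w}.

(* Values of (beta(1/2), beta(tau), rho(tau)) over all structures of the model,
   normalized by rho(1/2) = 1 and restricted by rho(tau) > 0, that generate
   [Pobs]. *)
Definition sharp_identified_set (Pobs : probability (obs R T k) R) (tau : R) :
    set (par R k) :=
  [set theta | exists (beta : R -> k.-tuple R) (rho : R -> R),
    [/\ theta = (beta 2^-1, beta tau, rho tau), rho 2^-1 = 1, 0 < rho tau &
        exists P : probability (full R T k) R,
          has_obs_marginal Pobs P /\ quantile_model tau beta rho P]].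

(* With [cprobP], the next lemmas ensure that the occurrences of [cprob] above
   are genuine conditional probabilities. *)
Lemma measurable_XA : measurable_fun [set: full R T k] XA.
Proof.
apply: measurable_fun_pair => //.
exact: measurableT_comp.
Qed.

Lemma measurable_At : measurable_fun [set: full R T k] At.
Proof. exact: measurable_snd. Qed.

Lemma measurable_Yt t : measurable_fun [set: full R T k] (Yt t).
Proof.
apply: (measurableT_comp (measurable_tnth t)).
exact: measurableT_comp.
Qed.

Lemma measurable_dotp t b :
  measurable_fun [set: full R T k] (fun w => dotp (Xt t w) b).
Proof.
apply: measurable_sum => j; apply: measurable_funM => //.
apply: (measurableT_comp (measurable_tnth j)).
apply: (measurableT_comp (measurable_tnth t)).
exact: measurableT_comp.
Qed.

Lemma measurable_residual theta l t :
  measurable_fun [set: full R T k] (residual theta l t).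
Proof.
case: theta => -[b0 b1] r; rewrite /residual.
case: (l == ord0); last apply: measurable_funM => //;
  by apply: measurable_funB; [exact: measurable_Yt|exact: measurable_dotp].
Qed.

Lemma measurable_le_event (f g : full R T k -> R) :
  measurable_fun [set: full R T k] f -> measurable_fun [set: full R T k] g ->
  measurable [set v | f v <= g v] /\ measurable [set v | f v < g v].
Proof.
move=> mf mg; split.
- by have := measurable_fun_ler mf mg measurableT (Y := [set true]) I; rewrite setTI.
- by have := measurable_fun_ltr mf mg measurableT (Y := [set true]) I; rewrite setTI.
Qed.

End model.

(* Main.v *)
Require Import Defs.
From mathcomp Require Import all_boot all_order all_algebra.
From mathcomp Require Import all_classical all_reals all_analysis.
From mathcomp Require Import measurable_realfun.

Import Order.TTheory GRing.Theory Num.Theory.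

Local Open Scope classical_set_scope.
Local Open Scope ring_scope.

(** Both sides constrain conditional probabilities of the same events. Clearing the denominator
    $r>0$ turns $Z_{\ell t}(\theta)\le A$ into $Y_t\le X_t'b_\ell+\rho(q_\ell)A$, with $\rho(1/2)=1$
    and $\rho(\tau)=r$, and likewise for the strict inequalities ([residual_events]). Hence one and
    the same law $P$ witnesses both conditions ([coupling_set_quantile_model]). What remains is to
    pass between a triple $(b_0,b_1,r)$ and the functions [beta], [rho] of the model, which is
    possible because the two levels are distinct ([two_level_functions]). *)

Lemma residual_events {R : realType} {T k : nat} (tau : R)
    (beta : R -> k.-tuple R) (rho : R -> R) (l : 'I_2) (t : 'I_T) :
  rho 2^-1 = 1 -> 0 < rho tau ->
  let theta := (beta 2^-1, beta tau, rho tau) in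
  let q := qlevel tau l in
  [set v | residual theta l t v <= At v] =
    [set v | Yt t v <= dotp (Xt t v) (beta q) + rho q * At v] /\
  [set v | residual theta l t v < At v] =
    [set v | Yt t v < dotp (Xt t v) (beta q) + rho q * At v].
Proof.
move=> rho1 rho0; rewrite /= /qlevel; case: (l == ord0).
  by split; apply/seteqP; split=> v /=; rewrite rho1 mul1r ?lerBlDl ?ltrBlDl.
by split; apply/seteqP; split=> v /=;
  rewrite ?ler_pdivrMr ?ltr_pdivrMr// ?lerBlDl ?ltrBlDl mulrC.
Qed.

(** The events are equal as sets, so the chosen versions [cprob] coincide everywhere and the same
    exceptional null set serves both directions. *)
Lemma coupling_set_quantile_model {R : realType} {T k : nat} (tau : R)
    (Pobs : probability (T.-tuple R * T.-tuple (k.-tuple R))%type R)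
    (beta : R -> k.-tuple R) (rho : R -> R)
    (P : probability (T.-tuple R * T.-tuple (k.-tuple R) * R)%type R) :
  rho 2^-1 = 1 -> 0 < rho tau ->
  coupling_set Pobs tau (beta 2^-1, beta tau, rho tau) P <->
  has_obs_marginal Pobs P /\ quantile_model tau beta rho P.
Proof.
move=> rho1 rho0.
have ev l t := @residual_events R T k tau beta rho l t rho1 rho0.
split=> -[margP aeP]; split => //; apply: filterS aeP => w aew l t;
  by have [leE ltE] := ev l t; have := aew l t; rewrite /cond_quantile leE ltE.
Qed.

Lemma quantile_modelE {R : realType} {T k : nat} (tau : R)
    (beta : R -> k.-tuple R) (rho : R -> R)
    (P : probability (T.-tuple R * T.-tuple (k.-tuple R) * R)%type R) :
  rho 2^-1 = 1 ->
  quantile_model tau beta rho P <->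
  {ae P, forall w, forall t : 'I_T,
    [/\ 2^-1 <= cprob P XA
          [set v | Yt t v <= dotp (Xt t v) (beta 2^-1) + At v] (XA w),
        cprob P XA
          [set v | Yt t v < dotp (Xt t v) (beta 2^-1) + At v] (XA w) <= 2^-1,
        tau <= cprob P XA
          [set v | Yt t v <= dotp (Xt t v) (beta tau) + rho tau * At v] (XA w) &
        cprob P XA
          [set v | Yt t v < dotp (Xt t v) (beta tau) + rho tau * At v] (XA w)
          <= tau]}.
Proof.
move=> rho1.
have leE t : [set v : T.-tuple R * T.-tuple (k.-tuple R) * R |
    Yt t v <= dotp (Xt t v) (beta 2^-1) + rho 2^-1 * At v] =
    [set v | Yt t v <= dotp (Xt t v) (beta 2^-1) + At v].
  by apply/seteqP; split=> v /=; rewrite rho1 mul1r.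
have ltE t : [set v : T.-tuple R * T.-tuple (k.-tuple R) * R |
    Yt t v < dotp (Xt t v) (beta 2^-1) + rho 2^-1 * At v] =
    [set v | Yt t v < dotp (Xt t v) (beta 2^-1) + At v].
  by apply/seteqP; split=> v /=; rewrite rho1 mul1r.
split; apply: filterS => w aew.
(* In ['I_2], [ord0] carries the level 1/2 and [ord_max] the level [tau]. *)
- move=> t; have := aew ord0 t; have := aew ord_max t.
  by rewrite /qlevel /cond_quantile /= leE ltE => -[? ?] [? ?]; split.
- move=> l t; have [le0 lt0 le1 lt1] := aew t.
  by rewrite /qlevel /cond_quantile; case: (l == ord0); rewrite ?leE ?ltE.
Qed.

(** If [tau] were 1/2, the values prescribed at the two levels could conflict; since they differ, a
    case split on [q == 2^-1] realizes any triple. *)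
Lemma two_level_functions {R : realType} {k : nat} (tau : R)
    (b0 b1 : k.-tuple R) (r : R) : tau != 2^-1 ->
  exists (beta : R -> k.-tuple R) (rho : R -> R),
    [/\ beta 2^-1 = b0, beta tau = b1, rho 2^-1 = 1 & rho tau = r].
Proof.
move=> /negbTE tauN; exists (fun q => if q == 2^-1 then b0 else b1).
by exists (fun q => if q == 2^-1 then 1 else r); rewrite eqxx tauN.
Qed.

Theorem proposition8p6 (R : realType) (T k : nat) (tau : R)
    (Pobs : probability (T.-tuple R * T.-tuple (k.-tuple R))%type R) :
  (0 < T)%N -> (0 < k)%N -> 0 < tau < 1 -> tau != 2^-1 ->
  Theta_I Pobs tau = sharp_identified_set Pobs tau /\
  forall (b0 b1 : k.-tuple R) (r : R), 0 < r ->
    (Theta_I Pobs tau (b0, b1, r) <->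
     exists P : probability
         (T.-tuple R * T.-tuple (k.-tuple R) * R)%type R,
       has_obs_marginal Pobs P /\
       {ae P, forall w, forall t : 'I_T,
         [/\ 2^-1 <= cprob P XA
               [set v | Yt t v <= dotp (Xt t v) b0 + At v] (XA w),
             cprob P XA
               [set v | Yt t v < dotp (Xt t v) b0 + At v] (XA w) <= 2^-1,
             tau <= cprob P XA
               [set v | Yt t v <= dotp (Xt t v) b1 + r * At v] (XA w) &
             cprob P XA
               [set v | Yt t v < dotp (Xt t v) b1 + r * At v] (XA w)
               <= tau]}).
Proof.
move=> _ _ _ tauN; split.
- apply/seteqP; split=> [[[b0 b1] r] /= [r0 [P CP]]|theta].
  + have [beta [rho [b0E b1E rho1 rE]]] := two_level_functions tau b0 b1 r tauN.
    exists beta, rho; split; rewrite ?b0E ?b1E ?rE//; exists P.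
    by apply/coupling_set_quantile_model; rewrite ?b0E ?b1E ?rE.
  + move=> [beta [rho [-> rho1 rho0 [P QP]]]]; split => //; exists P.
    exact/coupling_set_quantile_model.
- move=> b0 b1 r r0.
  have [beta [rho [<- <- rho1 rE]]] := two_level_functions tau b0 b1 r tauN.
  (* The triple now reads [(beta 2^-1, beta tau, rho tau)], the form to which the two equivalences
     above apply. *)
  move: r0; rewrite -{r}rE => rho0; split=> [[_ [P]]|[P [margP aeP]]].
  + move=> /(coupling_set_quantile_model _ _ _ _ _ rho1 rho0)[margP QP].
    by exists P; split => //; apply/quantile_modelE.
  + split => //; exists P; apply/coupling_set_quantile_model => //.
    by split => //; apply/quantile_modelE.
Qed.
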